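(* Let $f:\mathbb Z_+\to\mathbb R$ be a function. Then $$\sum_{x\in\mathbb Z_+}K(\cdot,x)f(x)\in\mathcal H(K)\quad\Longleftrightarrow\quad L^*f\in\ell^2(\mathbb Z_+).$$ Here the left-hand condition means that for every $y\in\mathbb Z_+$ the series $\sum_{x=0}^\infty K(y,x)f(x)$ converges and that the resulting function of $y$ belongs to $\mathcal H(K)$; the right-hand condition means that for every $n\in\mathbb Z_+$ the series $(L^*f)(n)=\sum_{x=n}^\infty\binom{x}{n}f(x)$ converges and that the resulting sequence is square summable.
   Context: $\mathbb Z_+=\{0,1,2,\ldots\}$. The function $K(x,y)=\binom{x+y}{x}=\sum_{n=0}^{\min(x,y)}\binom{x}{n}\binom{y}{n}$ is positive definite on $\mathbb Z_+$, and $\mathcal H(K)$ is the reproducing kernel Hilbert space of real-valued functions on $\mathbb Z_+$ with reproducing kernel $K$. With $e_n(x)=\binom{x}{n}$ for $x\ge n$ and $e_n(x)=0$ for $x<n$, $\mathcal H(K)$ consists of the functions $g=\sum_{n=0}^\infty a_ne_n$ with $a_n\in\mathbb R$, $\sum a_n^2<\infty$, with norm $\|g\|^2=\sum a_n^2$. $L$ is the infinite lower triangular matrix $L_{(x,y)}=\binom{x}{y}$ if $0\le y\le x$, and $0$ otherwise ($x$ row index, $y$ column index), and $L^*$ is its transpose. Series are ordinary limits of partial sums. *)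

(* Defs.v *)
From mathcomp Require Import all_boot all_order all_algebra.
From mathcomp Require Import all_classical all_reals all_analysis.
From mathcomp Require Import ring lra.
Set Implicit Arguments.
Unset Strict Implicit.
Unset Printing Implicit Defensive.
Import Order.TTheory GRing.Theory Num.Theory.
Import numFieldNormedType.Exports.
Local Open Scope classical_set_scope.
Local Open Scope ring_scope.

Definition dot_norm (R : realType) (X : Type)
    (dot : (X -> R) -> (X -> R) -> R) (g : X -> R) : R :=
  Num.sqrt (dot g g).

(* [H] is the carrier, [dot] its inner product; the values of [dot] outside
   [H] are irrelevant. *)
Record is_rkhs (R : realType) (X : Type) (K : X -> X -> R)
    (H : set (X -> R)) (dot : (X -> R) -> (X -> R) -> R) : Prop := IsRkhs {
  rkhs_zero : H (fun=> 0);
  rkhs_linear : forall (a : R) g h, H g -> H h -> H (fun x => a * g x + h x);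
  rkhs_dotC : forall g h, H g -> H h -> dot g h = dot h g;
  rkhs_dot_linear : forall (a : R) g h k, H g -> H h -> H k ->
    dot (fun x => a * g x + h x) k = a * dot g k + dot h k;
  rkhs_dot_gt0 : forall g, H g -> g <> (fun=> 0) -> 0 < dot g g;
  rkhs_complete : forall u : nat -> X -> R,
    (forall n, H (u n)) ->
    (forall e : R, 0 < e -> exists N : nat, forall m n : nat,
      (N <= m)%N -> (N <= n)%N ->
      dot_norm dot (fun x => u m x - u n x) < e) ->
    exists2 g, H g &
      (fun n : nat => dot_norm dot (fun x => u n x - g x)) @ \oo --> (0 : R);
  rkhs_kernel : forall x, H (fun y => K y x);
  rkhs_reproducing : forall g x, H g -> dot g (fun y => K y x) = g x
}.

(* Infinite matrices [A : nat -> nat -> R], row index first.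
   [inf_mulmx A f] is only meaningful when [inf_mulmx_cvg A f] holds. *)
Definition inf_mulmx_cvg (R : realType) (A : nat -> nat -> R) (f : nat -> R) :
    Prop :=
  forall n : nat, cvgn (series (fun x : nat => A n x * f x)).

Definition inf_mulmx (R : realType) (A : nat -> nat -> R) (f : nat -> R) :
    nat -> R :=
  fun n => limn (series (fun x : nat => A n x * f x)).

Definition inf_trmx (R : realType) (A : nat -> nat -> R) : nat -> nat -> R :=
  fun x y => A y x.

Definition ell2 (R : realType) (a : nat -> R) : Prop :=
  cvgn (series (fun n : nat => a n ^+ 2)).

Definition binK (R : realType) : nat -> nat -> R :=
  fun x y => 'C(x + y, x)%:R.

(* inf_mulmx (inf_trmx binL) f n is the series \sum_(x >= n) 'C(x, n) f(x):
   its terms of index x < n are 0. *)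
Definition binL (R : realType) : nat -> nat -> R :=
  fun x y => if (y <= x)%N then 'C(x, y)%:R else 0.

(* \sum_n a_n e_n with e_n(x) = 'C(x, n); at x all terms with n > x vanish. *)
Definition bin_expansion (R : realType) (a : nat -> R) : nat -> R :=
  fun x => \sum_(n < x.+1) a n * 'C(x, n)%:R.

Definition ell2_dot (R : realType) (a b : nat -> R) : R :=
  limn (series (fun n : nat => a n * b n)).

Lemma ell2_mul_cvg (R : realType) (a b : nat -> R) : ell2 a -> ell2 b ->
  cvgn (series (fun n : nat => a n * b n)).
Proof.
move=> ha hb; apply: normed_cvg.
apply: (@series_le_cvg _ _ ((fun n => a n ^+ 2) + (fun n => b n ^+ 2))) => //=.
- by move=> n; rewrite addr_ge0 ?sqr_ge0.
- move=> n; rewrite fctE; apply/ler_normlP; split.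
  + have := sqr_ge0 (a n + b n); have := sqr_ge0 (a n); have := sqr_ge0 (b n).
    by rewrite !expr2; nra.
  + have := sqr_ge0 (a n - b n); have := sqr_ge0 (a n); have := sqr_ge0 (b n).
    by rewrite !expr2; nra.
- exact: is_cvg_seriesD.
Qed.

Lemma ell2_linear (R : realType) (t : R) (a b : nat -> R) :
  ell2 a -> ell2 b -> ell2 (fun n => t * a n + b n).
Proof.
move=> ha hb; rewrite /ell2.
have hab := ell2_mul_cvg ha hb.
rewrite (_ : (fun n => _) = t ^+ 2 *: (fun n => a n ^+ 2)
  + (2 * t) *: (fun n => a n * b n) + (fun n => b n ^+ 2)); last first.
  by apply/funext => n; rewrite !fctE /=; rewrite /GRing.scale /=; ring.
by apply: is_cvg_seriesD => //; apply: is_cvg_seriesD; exact: is_cvg_seriesZ.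
Qed.

Lemma ell2_sub (R : realType) (a b : nat -> R) :
  ell2 a -> ell2 b -> ell2 (fun n => a n - b n).
Proof.
move=> ha hb; rewrite (_ : (fun n => _) = (fun n => -1 * b n + a n)).
  exact: ell2_linear.
by apply/funext => n; ring.
Qed.

Lemma ell2_finite (R : realType) (a : nat -> R) (N : nat) :
  (forall n, (N <= n)%N -> a n = 0) -> ell2 a.
Proof.
move=> h; rewrite /ell2; apply/cvg_ex; exists (\sum_(0 <= k < N) a k ^+ 2).
apply: cvg_near_cst; near=> n.
have Nn : (N <= n)%N by near: n; exact: nbhs_infty_ge.
have h0 : \sum_(N <= k < n) a k ^+ 2 = 0.
  by rewrite big_nat_cond big1// => i /andP[/andP[/h -> _] _]; rewrite expr0n.
by rewrite /series /= (big_cat_nat (n := N))//= h0 addr0.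
Unshelve. all: by end_near. Qed.

Lemma ell2_dotC (R : realType) (a b : nat -> R) : ell2_dot a b = ell2_dot b a.
Proof. by congr (limn (series _)); apply/funext => n; rewrite mulrC. Qed.

Lemma ell2_dot_linear (R : realType) (t : R) (a b c : nat -> R) :
  ell2 a -> ell2 b -> ell2 c ->
  ell2_dot (fun n => t * a n + b n) c = t * ell2_dot a c + ell2_dot b c.
Proof.
move=> ha hb hc; rewrite /ell2_dot.
rewrite (_ : (fun n => _) = t *: (fun n => a n * c n) + (fun n => b n * c n)).
  rewrite lim_seriesD; last 2 first.
  - exact/is_cvg_seriesZ/ell2_mul_cvg.
  - exact: ell2_mul_cvg.
  by rewrite lim_seriesZ//; exact: ell2_mul_cvg.
by apply/funext => n; rewrite !fctE /GRing.scale /=; ring.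
Qed.

Lemma ell2_dot_ge_sum (R : realType) (a : nat -> R) (N : nat) : ell2 a ->
  \sum_(0 <= n < N) a n ^+ 2 <= ell2_dot a a.
Proof.
move=> ha; rewrite /ell2_dot.
rewrite (_ : (fun n => a n * a n) = (fun n => a n ^+ 2)) //.
apply: (@nondecreasing_cvgn_le _ (series (fun n => a n ^+ 2))) => //.
apply/nondecreasing_seqP => n.
by rewrite /series /= big_nat_recr//= lerDl sqr_ge0.
Qed.

Lemma ell2_dot_ge_term (R : realType) (a : nat -> R) (n : nat) : ell2 a ->
  a n ^+ 2 <= ell2_dot a a.
Proof.
move=> ha; apply: le_trans (ell2_dot_ge_sum n.+1 ha).
by rewrite big_nat_recr//= lerDr sumr_ge0// => i _; rewrite sqr_ge0.
Qed.

Lemma ell2_bounded (R : realType) (a : nat -> R) (M : R) :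
  (forall N : nat, \sum_(0 <= n < N) a n ^+ 2 <= M) ->
  ell2 a /\ ell2_dot a a <= M.
Proof.
move=> hM.
have nd : nondecreasing_seq (series (fun n => a n ^+ 2)).
  apply/nondecreasing_seqP => n.
  by rewrite /series /= big_nat_recr//= lerDl sqr_ge0.
have ha : ell2 a.
  apply: nondecreasing_is_cvgn => //.
  by exists M => _ [N _ <-]; exact: hM.
split=> //; apply: limr_le => //.
by apply: nearW => N; exact: hM.
Qed.

Lemma ell2_complete (R : realType) (u : nat -> nat -> R) :
  (forall k, ell2 (u k)) ->
  (forall e : R, 0 < e -> exists N : nat, forall m n : nat,
     (N <= m)%N -> (N <= n)%N ->
     ell2_dot (fun i => u m i - u n i) (fun i => u m i - u n i) < e) ->
  exists2 a, ell2 a & forall e : R, 0 < e -> exists N : nat, forall n : nat,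
     (N <= n)%N ->
     ell2_dot (fun i => u n i - a i) (fun i => u n i - a i) <= e.
Proof.
move=> hu hC.
have cu i : cvgn (fun k : nat => u k i).
  apply/cauchy_cvgP; apply: cauchy_exP => e e0.
  have [N hN] := hC _ (exprn_gt0 2 e0).
  exists (u N i).
  suff : \forall n \near \oo, ball (u N i) e (u n i) by [].
  near=> n; rewrite /ball /=.
  have Nn : (N <= n)%N by near: n; exact: nbhs_infty_ge.
  have := le_lt_trans (ell2_dot_ge_term i (ell2_sub (hu N) (hu n)))
    (hN N n (leqnn N) Nn).
  rewrite -[X in X < _]real_normK ?num_real// ltr_pXn2r// nnegrE.
  exact: ltW.
pose a i := limn (fun k : nat => u k i).
have key e : 0 < e -> exists N : nat, forall n, (N <= n)%N ->
    ell2 (fun i => u n i - a i) /\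
    ell2_dot (fun i => u n i - a i) (fun i => u n i - a i) <= e.
  move=> e0; have [N hN] := hC _ e0; exists N => n Nn.
  apply: ell2_bounded => M.
  have cM : (fun m : nat => \sum_(0 <= i < M) (u n i - u m i) ^+ 2) @ \oo
      --> \sum_(0 <= i < M) (u n i - a i) ^+ 2.
    elim: M => [|M IH].
      by under eq_fun do rewrite big_geq//; rewrite big_geq//; exact: cvg_cst.
    under eq_fun do rewrite big_nat_recr//=.
    rewrite big_nat_recr//=; apply: cvgD => //.
    under eq_fun do rewrite expr2.
    by rewrite expr2; apply: cvgM; apply: cvgB => //; exact: cvg_cst.
  rewrite -(cvg_lim _ cM)//; apply: limr_le; first by apply/cvg_ex; eexists; exact: cM.
  near=> m; apply: ltW; apply: le_lt_trans (hN n m Nn _).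
    exact/ell2_dot_ge_sum/ell2_sub.
  by near: m; exact: nbhs_infty_ge.
have [N hN] := key 1 ltr01.
exists a; last by move=> e /key[N' hN']; exists N' => n /hN'[].
have [hNa _] := hN N (leqnn N).
have := ell2_sub (hu N) hNa; congr ell2.
by apply/funext => i; ring.
Unshelve. all: by end_near. Qed.

Lemma bin_expansion_linear (R : realType) (t : R) (a b : nat -> R) :
  bin_expansion (fun n => t * a n + b n) =
  (fun x => t * bin_expansion a x + bin_expansion b x).
Proof.
apply/funext => x; rewrite /bin_expansion mulr_sumr -big_split/=.
by apply: eq_bigr => i _; ring.
Qed.

Lemma bin_expansion_inj (R : realType) : injective (@bin_expansion R).
Proof.
move=> a b ab; apply/funext => n; elim/ltn_ind: n => n IH.
have := congr1 (@^~ n) ab; rewrite /bin_expansion !big_ord_recr/=.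
under eq_bigr => i _ do rewrite IH//.
by move/addrI; rewrite binn !mulr1.
Qed.

Lemma binK_expansion (R : realType) (x : nat) :
  (fun y => binK R y x) = bin_expansion (fun n => 'C(x, n)%:R).
Proof.
apply/funext => y; rewrite /binK /bin_expansion addnC -binomial.Vandermonde natr_sum.
by apply: eq_bigr => i _; rewrite natrM bin_sub// -ltnS.
Qed.

(* Existence of H(K), with the carrier and norm given by the (e_n) expansion. *)
Lemma binK_rkhs (R : realType) :
  exists2 dot : (nat -> R) -> (nat -> R) -> R,
    is_rkhs (@binK R) [set g | exists2 a, ell2 a & g = bin_expansion a] dot &
    forall a, ell2 a -> dot_norm dot (bin_expansion a) =
      Num.sqrt (limn (series (fun n : nat => a n ^+ 2))).
Proof.
have /choice[coef coefE] : forall g : nat -> R, exists b : nat -> R,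
    forall a, g = bin_expansion a -> b = a.
  move=> g; have [[a ->]|h] := pselect (exists a, g = bin_expansion a).
    by exists a => b /bin_expansion_inj.
  by exists (fun=> 0) => a ga; exfalso; apply: h; exists a.
have cK a : coef (bin_expansion a) = a by exact: coefE.
have ell2C x : ell2 (fun n => 'C(x, n)%:R : R).
  by apply: (@ell2_finite _ _ x.+1) => n xn; rewrite bin_small.
have ell20 : ell2 (fun=> 0 : R) by exact: (@ell2_finite _ _ 0).
have subE a b : (fun x => bin_expansion a x - bin_expansion b x) =
    bin_expansion (fun n => a n - b n) :> (nat -> R).
  transitivity (bin_expansion (fun n => -1 * b n + a n)).
    by rewrite bin_expansion_linear; apply: funext => x; ring.
  by congr bin_expansion; apply: funext => n; ring.
exists (fun g h => ell2_dot (coef g) (coef h)); last first.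
  by move=> a _; rewrite /dot_norm cK.
split.
- exists (fun=> 0) => //; apply/funext => x; rewrite /bin_expansion big1// => i _.
  by rewrite mul0r.
- move=> t g h [a ha ->] [b hb ->]; exists (fun n => t * a n + b n).
    exact: ell2_linear.
  by rewrite bin_expansion_linear.
- by move=> g h _ _; exact: ell2_dotC.
- move=> t g h k [a ha ->] [b hb ->] [c hc ->].
  by rewrite -bin_expansion_linear !cK ell2_dot_linear.
- move=> g [a ha ->] a0; rewrite cK.
  have [n an] : exists n, a n != 0.
    apply: contrapT => h; apply: a0; apply/funext => x.
    rewrite /bin_expansion big1// => i _.
    have [->|ai] := eqVneq (a i) 0; first by rewrite mul0r.
    by exfalso; apply: h; exists i.
  apply: lt_le_trans (ell2_dot_ge_term n ha).
  by rewrite lt0r sqrf_eq0 an sqr_ge0.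
- move=> u Hu hC.
  have /choice[v hv] : forall n, exists a, ell2 a /\ u n = bin_expansion a.
    by move=> n; have [a ha ->] := Hu n; exists a.
  have vl n : ell2 (v n) by case: (hv n).
  have uE n : u n = bin_expansion (v n) by case: (hv n).
  have [e e0|a ha cv] := ell2_complete vl.
    have [N hN] : exists N : nat, forall m n : nat, (N <= m)%N -> (N <= n)%N ->
        dot_norm (fun g h => ell2_dot (coef g) (coef h))
          (fun x => u m x - u n x) < Num.sqrt e by apply: hC; rewrite sqrtr_gt0.
    exists N => m n Nm Nn; have := hN m n Nm Nn.
    by rewrite /dot_norm !uE subE cK ltr_sqrt.
  exists (bin_expansion a); first by exists a.
  apply/cvgrPdist_le => e e0; have [N hN] := cv _ (exprn_gt0 2 e0).
  near=> n; rewrite sub0r normrN /dot_norm uE subE cK ger0_norm ?sqrtr_ge0//.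
  rewrite -(ger0_norm (ltW e0)) -sqrtr_sqr ler_wsqrtr// hN//.
  by near: n; exact: nbhs_infty_ge.
- by move=> x; exists (fun n => 'C(x, n)%:R) => //; exact: binK_expansion.
- move=> g x [a ha ->]; rewrite binK_expansion !cK /ell2_dot /bin_expansion.
  apply: cvg_lim => //; apply: cvg_near_cst; near=> n.
  have xn : (x.+1 <= n)%N by near: n; exact: nbhs_infty_ge.
  have h0 : \sum_(x.+1 <= k < n) a k * 'C(x, k)%:R = 0.
    by rewrite big_nat_cond big1// => i /andP[/andP[xi _] _]; rewrite bin_small ?mulr0.
  by rewrite /series /= (big_cat_nat (n := x.+1))//= h0 addr0 big_mkord.
Unshelve. all: by end_near. Qed.

(* Main.v *)
Require Import Defs.
From mathcomp Require Import all_boot all_order all_algebra.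
From mathcomp Require Import all_classical all_reals all_analysis.
From mathcomp Require Import ring lra.

(** The Vandermonde identity [K(y, x) = \sum_(n <= x) 'C(x, n) * 'C(y, n)]
    says that the columns of [K] arise from the columns [e_n] of [L] through
    the unitriangular matrix of binomial coefficients; as [K] is symmetric, the
    same holds for rows.  Such a matrix is inverted by finite linear
    combinations ([binomial_transform_closed]), and this one remark drives both
    halves of the argument.

    On the side of the series, the partial sums of [\sum_x K(y, x) f(x)] are
    finite combinations of those of [(L^* f)(n)], [n <= y], and conversely.
    Hence the two convergence conditions are equivalent, and in the limit
    [\sum_x K(y, x) f(x) = \sum_(n <= y) (L^* f)(n) e_n(y)]
    ([binK_mulmx_expansion]).

    On the side of the space, the theorem speaks of an arbitrary Hilbert space
    [H] reproduced by [K], so its elements have to be recognized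
    ([binK_rkhs_carrier]).  Inverting the triangular relation puts the [e_n]
    in [H], and the reproducing property forces them to be orthonormal.
    Moreover [g(x)], being the inner product of [g] with
    [K(., x) = \sum_(n <= x) 'C(x, n) e_n], is the binomial expansion at [x]
    of the Fourier coefficients of [g].  By the Bessel inequality these are
    square summable, and by the Riesz-Fischer theorem every square summable
    sequence occurs.

    So [\sum_x K(., x) f(x)] is the expansion with coefficients [L^* f], and
    it lies in [H] exactly when these are square summable, because an expansion
    determines its coefficients. *)

Set Implicit Arguments.
Unset Strict Implicit.
Unset Printing Implicit Defensive.
Import Order.TTheory GRing.Theory Num.Theory.
Import numFieldNormedType.Exports.
Local Open Scope classical_set_scope.
Local Open Scope ring_scope.

(** * Inverting the binomial transform *)

(** The coefficient of [v x] in the [x]-th sum is 1, so [v x] is that sum minus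
    a combination of the earlier [v n].  Both membership in [H] and
    convergence of a sequence are properties [S] of this kind. *)
Lemma binomial_transform_closed (R : realType) (V : lmodType R) (S : set V)
    (v : nat -> V) :
  S 0 -> (forall (a : R) u w, S u -> S w -> S (a *: u + w)) ->
  (forall x, S (\sum_(n < x.+1) 'C(x, n)%:R *: v n)) ->
  forall n, S (v n).
Proof.
move=> S0 Slin Sv; elim/ltn_ind => n IH.
have Ssum : S (\sum_(k < n) 'C(n, k)%:R *: v k).
  apply: (big_ind S) => // [u w Su Sw|k _].
    by rewrite -[u]scale1r; exact: Slin.
  by rewrite -[_ *: _]addr0; apply: Slin => //; exact: IH.
have := Slin (-1) _ _ Ssum (Sv n).
by rewrite big_ord_recr/= binn scale1r scaleN1r addKr.
Qed.

(** * Linear algebra in a reproducing kernel Hilbert space *)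

Lemma rkhs_sum (R : realType) (X : Type) (K : X -> X -> R) H dot
    (e : nat -> X -> R) (c : nat -> R) (N : nat) :
  is_rkhs K H dot -> (forall n, H (e n)) ->
  H (fun x => \sum_(n < N) c n * e n x).
Proof.
move=> rk He; elim: N => [|N IH].
  rewrite (_ : (fun _ => _) = (fun=> 0)); first exact: rkhs_zero rk.
  by apply/funext => x; rewrite big_ord0.
rewrite (_ : (fun _ => _) =
    (fun x => c N * e N x + \sum_(n < N) c n * e n x)).
  exact: (rkhs_linear rk).
by apply/funext => x; rewrite big_ord_recr/= addrC.
Qed.

Lemma rkhs_sub (R : realType) (X : Type) (K : X -> X -> R) H dot g h :
  is_rkhs K H dot -> H g -> H h -> H (fun x => g x - h x).
Proof.
move=> rk Hg Hh; rewrite (_ : (fun _ => _) = (fun x => -1 * h x + g x)).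
  exact: (rkhs_linear rk).
by apply/funext => x; ring.
Qed.

Lemma rkhs_dot0l (R : realType) (X : Type) (K : X -> X -> R) H dot g :
  is_rkhs K H dot -> H g -> dot (fun=> 0) g = 0.
Proof.
move=> rk Hg; have H0 := rkhs_zero rk.
have := rkhs_dot_linear rk (-1) H0 H0 Hg.
rewrite (_ : (fun _ => _) = (fun=> 0)); last by apply/funext => x; ring.
by rewrite mulN1r addNr.
Qed.

Lemma rkhs_dot_subl (R : realType) (X : Type) (K : X -> X -> R) H dot g h k :
  is_rkhs K H dot -> H g -> H h -> H k ->
  dot (fun x => g x - h x) k = dot g k - dot h k.
Proof.
move=> rk Hg Hh Hk; rewrite (_ : (fun _ => _) = (fun x => -1 * h x + g x)).
  by rewrite (rkhs_dot_linear rk)// mulN1r addrC.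
by apply/funext => x; ring.
Qed.

Lemma rkhs_dot_suml (R : realType) (X : Type) (K : X -> X -> R) H dot
    (e : nat -> X -> R) (c : nat -> R) (N : nat) g :
  is_rkhs K H dot -> (forall n, H (e n)) -> H g ->
  dot (fun x => \sum_(n < N) c n * e n x) g = \sum_(n < N) c n * dot (e n) g.
Proof.
move=> rk He Hg; elim: N => [|N IH].
  rewrite big_ord0 -[RHS](rkhs_dot0l rk Hg).
  by under eq_fun do rewrite big_ord0.
rewrite (_ : (fun _ => _) =
    (fun x => c N * e N x + \sum_(n < N) c n * e n x)).
  rewrite (rkhs_dot_linear rk)//; last exact: rkhs_sum rk He.
  by rewrite IH big_ord_recr/= addrC.
by apply/funext => x; rewrite big_ord_recr/= addrC.
Qed.

Lemma rkhs_dot_ge0 (R : realType) (X : Type) (K : X -> X -> R) H dot g :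
  is_rkhs K H dot -> H g -> 0 <= dot g g.
Proof.
move=> rk Hg; have [g0|gn0] := pselect (g = (fun=> 0)).
  by rewrite {1}g0 (rkhs_dot0l rk).
exact/ltW/(rkhs_dot_gt0 rk).
Qed.

Lemma rkhs_dot_sub_sqr (R : realType) (X : Type) (K : X -> X -> R) H dot g h :
  is_rkhs K H dot -> H g -> H h ->
  dot (fun x => g x - h x) (fun x => g x - h x) =
    dot g g - dot g h *+ 2 + dot h h.
Proof.
move=> rk Hg Hh; have Hgh := rkhs_sub rk Hg Hh.
rewrite (rkhs_dot_subl rk)// (rkhs_dotC rk Hg)// (rkhs_dotC rk Hh)//.
rewrite !(rkhs_dot_subl rk)// (rkhs_dotC rk Hh)//.
ring.
Qed.

(** * Orthonormal sequences *)

Lemma orthonormal_dot_sum (R : realType) (X : Type) (K : X -> X -> R) H dot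
    (e : nat -> X -> R) (c : nat -> R) (N k : nat) :
  is_rkhs K H dot -> (forall n, H (e n)) ->
  (forall m n, dot (e m) (e n) = (m == n)%:R) ->
  dot (fun x => \sum_(n < N) c n * e n x) (e k) = if (k < N)%N then c k else 0.
Proof.
move=> rk He orth; rewrite (rkhs_dot_suml _ _ rk)//.
under eq_bigr do rewrite orth.
case: ifPn => [kN|].
  rewrite (bigD1 (Ordinal kN))//= eqxx mulr1 big1 ?addr0// => i /eqP ik.
  by case: eqP => [ik'|_]; rewrite ?mulr0//; case: ik; exact: val_inj.
rewrite -leqNgt => Nk; rewrite big1// => i _.
by rewrite ltn_eqF ?mulr0// (leq_trans (ltn_ord i)).
Qed.

Lemma orthonormal_dot_sums (R : realType) (X : Type) (K : X -> X -> R) H dot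
    (e : nat -> X -> R) (c : nat -> R) (m n : nat) :
  is_rkhs K H dot -> (forall n, H (e n)) ->
  (forall m n, dot (e m) (e n) = (m == n)%:R) -> (n <= m)%N ->
  dot (fun x => \sum_(k < m) c k * e k x) (fun x => \sum_(k < n) c k * e k x) =
    \sum_(k < n) c k ^+ 2.
Proof.
move=> rk He orth nm; have Hs N := rkhs_sum c N rk He.
rewrite (rkhs_dotC rk)// (rkhs_dot_suml _ _ rk)//; apply: eq_bigr => k _.
rewrite (rkhs_dotC rk)// (orthonormal_dot_sum _ _ _ rk)//.
by rewrite (leq_trans (ltn_ord k) nm) expr2.
Qed.

Lemma bessel_sum (R : realType) (X : Type) (K : X -> X -> R) H dot
    (e : nat -> X -> R) (N : nat) g :
  is_rkhs K H dot -> (forall n, H (e n)) ->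
  (forall m n, dot (e m) (e n) = (m == n)%:R) -> H g ->
  \sum_(0 <= n < N) dot g (e n) ^+ 2 <= dot g g.
Proof.
move=> rk He orth Hg; rewrite big_mkord.
have Hs := rkhs_sum (fun n => dot g (e n)) N rk He.
have := rkhs_dot_ge0 rk (rkhs_sub rk Hg Hs).
rewrite (rkhs_dot_sub_sqr rk)//.
rewrite (orthonormal_dot_sums (fun n => dot g (e n)) rk)//.
rewrite (rkhs_dotC rk Hg)// (rkhs_dot_suml (fun n => dot g (e n)) _ rk)//.
under [X in _ - X *+ 2]eq_bigr do rewrite (rkhs_dotC rk (He _) Hg) -expr2.
by rewrite mulr2n; lra.
Qed.

Lemma bessel_ell2 (R : realType) (X : Type) (K : X -> X -> R) H dot
    (e : nat -> X -> R) g :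
  is_rkhs K H dot -> (forall n, H (e n)) ->
  (forall m n, dot (e m) (e n) = (m == n)%:R) -> H g ->
  ell2 (fun n => dot g (e n)).
Proof.
move=> rk He orth Hg.
by have [] := ell2_bounded (fun N => bessel_sum N rk He orth Hg).
Qed.

Lemma bessel_coef (R : realType) (X : Type) (K : X -> X -> R) H dot
    (e : nat -> X -> R) (n : nat) g :
  is_rkhs K H dot -> (forall n, H (e n)) ->
  (forall m n, dot (e m) (e n) = (m == n)%:R) -> H g ->
  `|dot g (e n)| <= dot_norm dot g.
Proof.
move=> rk He orth Hg; rewrite /dot_norm -sqrtr_sqr ler_wsqrtr//.
apply: le_trans (bessel_sum n.+1 rk He orth Hg).
by rewrite big_nat_recr//= lerDr sumr_ge0// => i _; rewrite sqr_ge0.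
Qed.

(** The partial sums [\sum_(n < N) a n * e n] have [\sum_(N <= n < M) (a n)^2]
    as squared distances, so they converge by completeness; the coefficients of
    the limit are read off from [bessel_coef], which makes them continuous. *)
Lemma riesz_fischer (R : realType) (X : Type) (K : X -> X -> R) H dot
    (e : nat -> X -> R) (a : nat -> R) :
  is_rkhs K H dot -> (forall n, H (e n)) ->
  (forall m n, dot (e m) (e n) = (m == n)%:R) -> ell2 a ->
  exists2 g, H g & forall n, dot g (e n) = a n.
Proof.
move=> rk He orth ha.
pose u N x := \sum_(n < N) a n * e n x.
pose s N := \sum_(n < N) a n ^+ 2.
have Hu N : H (u N) by exact: rkhs_sum rk He.
have dist m n : (n <= m)%N ->
    dot (fun x => u m x - u n x) (fun x => u m x - u n x) = s m - s n.
  move=> nm; rewrite (rkhs_dot_sub_sqr rk)// !(orthonormal_dot_sums _ rk)//.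
  by rewrite /s; ring.
have distC m n : dot (fun x => u m x - u n x) (fun x => u m x - u n x) =
    dot (fun x => u n x - u m x) (fun x => u n x - u m x).
  by rewrite !(rkhs_dot_sub_sqr rk)// (rkhs_dotC rk (Hu m))//; ring.
have dist_abs m n :
    dot (fun x => u m x - u n x) (fun x => u m x - u n x) = `|s m - s n|.
  have pos p q : (q <= p)%N -> 0 <= s p - s q.
    by move=> qp; rewrite -dist//; apply: (rkhs_dot_ge0 rk); exact: rkhs_sub rk _ _.
  have [nm|/ltnW mn] := leqP n m; first by rewrite dist// ger0_norm// pos.
  by rewrite distC dist// distrC ger0_norm// pos.
have cs : cvgn s.
  rewrite (_ : s = series (fun n => a n ^+ 2))//.
  by apply/funext => N; rewrite /series/= big_mkord.
have [eps eps0|g Hg cvu] := rkhs_complete rk Hu.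
  move/cvgrPdist_lt: cs => /(_ (eps ^+ 2 / 2)) [|N _ sN].
    by rewrite divr_gt0// exprn_gt0.
  exists N => m n Nm Nn; rewrite /dot_norm dist_abs.
  rewrite -[X in _ < X](ger0_norm (ltW eps0)) -[`|eps|]sqrtr_sqr ltr_sqrt ?exprn_gt0//.
  rewrite (le_lt_trans (ler_distD (limn s) _ _))// (splitr (eps ^+ 2)).
  by rewrite ltrD//; [rewrite distrC|]; exact: sN.
exists g => // n; apply/eqP; rewrite -subr_eq0 -normr_eq0 eq_le normr_ge0 andbT.
rewrite -(cvg_lim _ cvu)//; apply: limr_ge; first by apply/cvg_ex; exists 0.
near=> N.
have nN : (n < N)%N by near: N; exact: nbhs_infty_gt.
have := bessel_coef n rk He orth (rkhs_sub rk (Hu N) Hg).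
by rewrite (rkhs_dot_subl rk)// (orthonormal_dot_sum _ _ _ rk)// nN distrC.
Unshelve. all: by end_near. Qed.

(** * The space reproduced by the binomial kernel *)

Definition bin_basis (R : realType) (n : nat) : nat -> R := fun x => 'C(x, n)%:R.

Lemma binKC (R : realType) (x y : nat) : binK R x y = binK R y x.
Proof. by rewrite /binK -bin_sub ?leq_addr// addKn addnC. Qed.

Lemma binK_basis (R : realType) (x : nat) :
  (fun y => binK R y x) =
  (fun y => \sum_(n < x.+1) 'C(x, n)%:R * bin_basis R n y).
Proof.
apply/funext => y; rewrite binKC.
have /(congr1 (@^~ x)) /= -> := binK_expansion R y.
by apply: eq_bigr => n _; rewrite mulrC.
Qed.

Lemma bin_basis_mem (R : realType) H dot n :
  is_rkhs (@binK R) H dot -> H (bin_basis R n).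
Proof.
move=> rk; apply: (@binomial_transform_closed R (nat -> R) H) n.
- exact: rkhs_zero rk.
- by move=> a u w; exact: (rkhs_linear rk).
- move=> x; rewrite (_ : \sum_(_ < _) _ = (fun y => binK R y x)).
    exact: rkhs_kernel rk x.
  by rewrite binK_basis; apply/funext => y; rewrite fct_sumE.
Qed.

(** The reproducing property gives [<g, K(., x)> = g x]; expanding [K(., x)] in
    the [e_n] turns this into the expansion of [g] itself. *)
Lemma binK_rkhs_fourier (R : realType) H dot g :
  is_rkhs (@binK R) H dot -> H g ->
  bin_expansion (fun n => dot g (bin_basis R n)) = g.
Proof.
move=> rk Hg; apply/funext => x.
have He n := bin_basis_mem n rk.
rewrite -[RHS](rkhs_reproducing rk x Hg) binK_basis.
have Hs := rkhs_sum (fun n => 'C(x, n)%:R) x.+1 rk He.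
rewrite (rkhs_dotC rk)// (rkhs_dot_suml (fun n => 'C(x, n)%:R) _ rk)//.
by apply: eq_bigr => n _; rewrite mulrC (rkhs_dotC rk).
Qed.

(** The basis function [e_m] has the Fourier coefficients [<e_m, e_n>], and
    also the obvious expansion with coefficients [delta_(m, n)]; expansions are
    unique. *)
Lemma bin_basis_orthonormal (R : realType) H dot m n :
  is_rkhs (@binK R) H dot ->
  dot (bin_basis R m) (bin_basis R n) = (m == n)%:R.
Proof.
move=> rk.
apply: (congr1 (@^~ n) (x := fun n => dot (bin_basis R m) (bin_basis R n))
  (y := fun n => (m == n)%:R)).
apply: bin_expansion_inj; rewrite (binK_rkhs_fourier rk (bin_basis_mem m rk)).
apply/funext => x; rewrite /bin_expansion /bin_basis.
have [mx|xm] := leqP m x.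
  rewrite (bigD1 (Ordinal (mx : (m < x.+1)%N)))//= eqxx mul1r.
  rewrite big1 ?addr0// => i /eqP im.
  by case: eqP => [mi|_]; rewrite ?mul0r//; case: im; exact: val_inj.
rewrite bin_small// big1// => i _.
by rewrite gtn_eqF ?mul0r// (leq_trans (ltn_ord i)).
Qed.

Lemma binK_rkhs_carrier (R : realType) H dot g :
  is_rkhs (@binK R) H dot ->
  H g <-> exists2 a, ell2 a & g = bin_expansion a.
Proof.
move=> rk; have He n := bin_basis_mem n rk.
have orth m n := bin_basis_orthonormal m n rk.
split=> [Hg|[a ha ->]].
  exists (fun n => dot g (bin_basis R n)); first exact: (bessel_ell2 rk).
  by rewrite (binK_rkhs_fourier rk).
have [h Hh /funext ha'] := riesz_fischer rk He orth ha.
by rewrite -ha' (binK_rkhs_fourier rk).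
Qed.

(** * The series defining the two transforms *)

Lemma binL_tr_bin (R : realType) n x : inf_trmx (@binL R) n x = 'C(x, n)%:R.
Proof.
by rewrite /inf_trmx /binL; case: leqP => // xn; rewrite bin_small.
Qed.

Lemma binK_series (R : realType) (f : nat -> R) (y : nat) :
  series (fun x => binK R y x * f x) =
  \sum_(n < y.+1) 'C(y, n)%:R *: series (fun x => inf_trmx (@binL R) n x * f x).
Proof.
apply/funext => N; rewrite fct_sumE /series/=.
under [RHS]eq_bigr => n _ do rewrite fctE /= scaler_sumr.
rewrite exchange_big/=; apply: eq_bigr => x _.
have /(congr1 (@^~ y)) /= -> := binK_expansion R x.
rewrite /bin_expansion mulr_suml; apply: eq_bigr => n _.
by rewrite binL_tr_bin /GRing.scale/=; ring.
Qed.

Lemma binK_mulmx_expansion (R : realType) (f : nat -> R) :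
  inf_mulmx_cvg (inf_trmx (@binL R)) f ->
  inf_mulmx_cvg (@binK R) f /\
  inf_mulmx (@binK R) f = bin_expansion (inf_mulmx (inf_trmx (@binL R)) f).
Proof.
move=> cL.
have cK y : series (fun x => binK R y x * f x) @ \oo -->
    bin_expansion (inf_mulmx (inf_trmx (@binL R)) f) y.
  rewrite binK_series /bin_expansion.
  under [X in _ --> X]eq_bigr do rewrite mulrC.
  rewrite [X in X @ _](_ : _ = (fun N => \sum_(n < y.+1) 'C(y, n)%:R *
      series (fun x => inf_trmx (@binL R) n x * f x) N)).
    apply: cvg_big => [|n _]; first exact: add_continuous.
    by apply: cvgM; [exact: cvg_cst|exact: cL].
  by apply/funext => N; rewrite fct_sumE.
split=> [y|]; first by apply/cvg_ex; eexists; exact: cK.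
by apply/funext => y; exact/cvg_lim/cK.
Qed.

Lemma binL_tr_mulmx_cvg (R : realType) (f : nat -> R) :
  inf_mulmx_cvg (@binK R) f -> inf_mulmx_cvg (inf_trmx (@binL R)) f.
Proof.
move=> cK.
apply: (@binomial_transform_closed R (nat -> R) [set u | cvgn u]).
- exact: is_cvg_cst.
- move=> a u w cu cw; apply: is_cvgD => //; exact: is_cvgZr.
- by move=> y; rewrite -binK_series; exact: cK.
Qed.

Theorem theorem1p1 (R : realType) (H : set (nat -> R))
    (dot : (nat -> R) -> (nat -> R) -> R)
    (H_rkhs : is_rkhs (@binK R) H dot) (f : nat -> R) :
  (inf_mulmx_cvg (@binK R) f /\ H (inf_mulmx (@binK R) f)) <->
  (inf_mulmx_cvg (inf_trmx (@binL R)) f /\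
   ell2 (inf_mulmx (inf_trmx (@binL R)) f)).
Proof.
split=> [[/binL_tr_mulmx_cvg cL HK]|[cL hL]]; split=> //.
- move: HK; rewrite (binK_mulmx_expansion cL).2.
  by case/(binK_rkhs_carrier _ H_rkhs) => a ha /bin_expansion_inj ->.
- exact: (binK_mulmx_expansion cL).1.
- rewrite (binK_mulmx_expansion cL).2; apply/(binK_rkhs_carrier _ H_rkhs).
  by exists (inf_mulmx (inf_trmx (@binL R)) f).
Qed.
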